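(* Let $n\ge 1$ and let $\mathcal{A}$ be a real *-subalgebra of $M_n$. Then the orthogonal projection $\mathcal{D}(M_n)\to\mathcal{D}(\mathcal{A})$ is a retraction, and the convex set $\mathcal{D}(\mathcal{A})$ is stable.
   Context: $M_n$ is the algebra of complex $n\times n$ matrices, $I_n$ the identity matrix, $A^*$ the conjugate transpose of $A$, and $\langle A,B\rangle:=\operatorname{tr}(A^*B)$. A real matrix system on $\mathbb{C}^n$ is a real linear subspace $\mathcal{R}\subset M_n$ such that $A^*\in\mathcal{R}$ for all $A\in\mathcal{R}$ and $I_n\in\mathcal{R}$. A real *-subalgebra of $M_n$ is a real matrix system on $\mathbb{C}^n$ that is closed under matrix multiplication. For a real matrix system $\mathcal{R}$ put: $\mathcal{H}(\mathcal{R}):=\{A\in\mathcal{R}: A^*=A\}$; $\mathcal{C}(\mathcal{R})$ the cone of positive semidefinite matrices in $\mathcal{R}$; $\mathcal{C}(\mathcal{R})^\vee:=\{A\in\mathcal{H}(\mathcal{R}): \langle A,B\rangle\ge 0 \text{ for all } B\in\mathcal{C}(\mathcal{R})\}$; and $\mathcal{D}(\mathcal{R}):=\{\rho\in\mathcal{C}(\mathcal{R})^\vee:\operatorname{tr}(\rho)=1\}$, a compact convex set. The orthogonal projection of $M_n$ onto $\mathcal{A}$ is the real linear map $\pi:M_n\to\mathcal{A}$ determined by $\operatorname{Re}\langle A-\pi(A),B\rangle=0$ for all $B\in\mathcal{A}$. It maps $\mathcal{D}(M_n)$ into $\mathcal{D}(\mathcal{A})$; its restriction $\mathcal{D}(M_n)\to\mathcal{D}(\mathcal{A})$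 is called the orthogonal projection of $\mathcal{D}(M_n)$ onto $\mathcal{D}(\mathcal{A})$. A retraction is an affine map $f:K\to L$ between compact convex sets $K,L$ that is left-inverse to some affine map $g:L\to K$ (that is, $f\circ g=\mathrm{id}_L$). A convex subset $K$ of a Euclidean space is stable if the midpoint map $K\times K\to K$, $(x,y)\mapsto\frac12(x+y)$ is open (for the relative Euclidean topologies), i.e. images of open subsets of $K\times K$ are open in $K$. *)

(* Defs.v *)
From HB Require Import structures.
From mathcomp Require Import all_boot all_order all_algebra.
From mathcomp Require Import complex.
From mathcomp Require Import all_classical all_reals all_analysis.
Import numFieldNormedType.Exports.

Set Implicit Arguments.
Unset Strict Implicit.
Unset Printing Implicit Defensive.

Import Order.TTheory GRing.Theory Num.Theory.

Local Open Scope classical_set_scope.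
Local Open Scope ring_scope.
Local Open Scope sesquilinear_scope.

(* The definitions are stated over an arbitrary numClosedFieldType C and used
   with C = R[i] for R : realType. The order of C is the partial order for
   which 0 <= z means that z is real and nonnegative. In particular {i01 C}
   consists of the real numbers in [0, 1], so that the library's convexity for
   C-modules ([convex_set], _ <| t |> _) is convexity over the reals. The
   topology of 'M[C]_n is the topology of entrywise convergence, that is, the
   Euclidean one. *)

Section RealMatrixSystems.
Variables (C : numClosedFieldType) (n : nat).
Implicit Types (A B : 'M[C]_n) (S : set 'M[C]_n).

Definition mxinner A B : C := \tr (A ^t* *m B).

Definition real_subspace S : Prop :=
  S 0 /\ forall (a : C) A B, a \is Num.real -> S A -> S B -> S (a *: A + B).

Definition real_matrix_system S : Prop :=
  [/\ real_subspace S, (forall A, S A -> S (A ^t*)) & S 1%:M].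

Definition real_star_subalgebra S : Prop :=
  real_matrix_system S /\ forall A B, S A -> S B -> S (A *m B).

Definition hermitian_part S : set 'M[C]_n := [set A | S A /\ A ^t* = A].

Definition psdmx A : Prop :=
  A ^t* = A /\ forall x : 'cV[C]_n, 0 <= (x ^t* *m A *m x) 0 0.

Definition psd_cone S : set 'M[C]_n := [set A | S A /\ psdmx A].

Definition dual_cone S : set 'M[C]_n :=
  [set A | hermitian_part S A /\ forall B, psd_cone S B -> 0 <= mxinner A B].

Definition state_space S : set 'M[C]_n :=
  [set rho | dual_cone S rho /\ \tr rho = 1].

Definition real_linear (f : 'M[C]_n -> 'M[C]_n) : Prop :=
  forall (a : C) A B, a \is Num.real -> f (a *: A + B) = a *: f A + f B.

Definition is_orthogonal_projection S (f : 'M[C]_n -> 'M[C]_n) : Prop :=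
  [/\ real_linear f, (forall A, S (f A)) &
      forall A B, S B -> 'Re (mxinner (A - f A) B) = 0].

(* When S is a real subspace there is exactly one such map; the default value
   is irrelevant. *)
Definition orthogonal_projection S : 'M[C]_n -> 'M[C]_n :=
  xget (fun=> 0) [set f | is_orthogonal_projection S f].

End RealMatrixSystems.

Section Convexity.
Variables (C : numClosedFieldType) (n : nat).
Implicit Types (K L : set 'M[C]_n) (f g : 'M[C]_n -> 'M[C]_n).
Local Open Scope convex_scope.

Definition compact_convex K : Prop := compact K /\ convex_set K.

Definition affine_map K L f : Prop :=
  set_fun K L f /\
  forall (t : {i01 C}) (x y : convex_lmodType 'M[C]_n), K x -> K y ->
    f (x <| t |> y) = (f x : convex_lmodType 'M[C]_n) <| t |> f y.

Definition retraction K L f : Prop :=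
  [/\ compact_convex K, compact_convex L, affine_map K L f &
      exists2 g, affine_map L K g & {in L, cancel g f}].

Definition midpoint (xy : 'M[C]_n * 'M[C]_n) : 'M[C]_n :=
  2^-1 *: (xy.1 + xy.2).

(* [subspace K] is the type of all matrices; its open sets trace the relative
   topology on K, and every point outside K is isolated. Hence the requirement
   that U be included in K `*` K. *)
Definition stable K : Prop :=
  convex_set K /\
  forall U : set ('M[C]_n * 'M[C]_n), U `<=` K `*` K ->
    open (U : set (subspace (K `*` K))) ->
    open (midpoint @` U : set (subspace K)).

End Convexity.

(* Main.v *)
Require Import Defs.
From HB Require Import structures.
From mathcomp Require Import all_boot all_order all_algebra.
From mathcomp Require Import complex.
From mathcomp Require Import all_classical all_reals all_analysis.
From mathcomp Require Import ring.
Import numFieldNormedType.Exports.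
Import Order.TTheory GRing.Theory Num.Theory.
Local Open Scope classical_set_scope.
Local Open Scope ring_scope.

Set Implicit Arguments.
Unset Strict Implicit.
Unset Printing Implicit Defensive.

(** Write [K] for the state space of the real *-subalgebra [S].

    Retraction. If [A] is a self-adjoint element of [S], then so is [f(A)] for
    every real function [f]: on the finite spectrum of [A], [f] is a real
    polynomial ([subalg_mxfun]). Testing an element of the dual cone of [S]
    against its own negative part therefore shows that it is positive
    semidefinite, so [K] consists of the density matrices that lie in [S]
    ([state_spaceE]). In particular [K] is contained in the set of all density
    matrices, and the inclusion is an affine right inverse of the orthogonal
    projection, which fixes [S] pointwise. That the projection maps states to
    states is the identity [Re <pi A, B> = Re <A, B>] for [B] in [S]
    ([proj_state]); that it exists follows from a maximal orthonormal family of
    [S] ([orthonormal_basis]).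

    Stability. Let [Z = (X + Y) / 2] in [K]. Given [Z'] in [K] near [Z] we must
    write [2 Z' = X' + Y'] with [X'] near [X] and [Y'] near [Y] in [K]. As
    [0 <= X <= 2 Z], we have [X = Z W Z] for [W = Z^+ X Z^+], where [Z^+] is the
    pseudo-inverse, and [W] lies in [S] ([order_factor]). The candidate is
    [Z' W Z'], normalised to trace 1 by adding a multiple of [Z']. Everything
    rests on the duality [W Z W <= mu W -> Z W Z <= mu Z] ([order_duality]):
    its hypothesis, unlike its conclusion, survives a perturbation of [Z],
    because the error [W (Z' - Z) W] is bounded by a small multiple of [W]
    ([order_perturb]). This gives [Z' W Z' <= (2 + small) Z'] without appealing
    to the continuity of the square root. The small excess is absorbed by first
    moving [X] and [Y] slightly towards [Z], which the openness of the given set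
    of pairs permits ([midpoint_lift], [state_stable]).

    Compactness of [K] holds because [K] is closed with entries in the closed
    unit disk, which is compact ([disk_compact]). *)

(** * Adjoints *)

Local Open Scope sesquilinear_scope.

Section Adjoint.
Variable C : numClosedFieldType.

Lemma adjmxD m n (A B : 'M[C]_(m, n)) : (A + B) ^t* = A ^t* + B ^t*.
Proof. by rewrite linearD map_mxD. Qed.

Lemma adjmxB m n (A B : 'M[C]_(m, n)) : (A - B) ^t* = A ^t* - B ^t*.
Proof. by rewrite linearB map_mxB. Qed.

Lemma adjmxZ m n (a : C) (A : 'M[C]_(m, n)) : (a *: A) ^t* = a^* *: A ^t*.
Proof. by rewrite linearZ map_mxZ. Qed.

Lemma adjmxM m n p (A : 'M[C]_(m, n)) (B : 'M[C]_(n, p)) :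
  (A *m B) ^t* = B ^t* *m A ^t*.
Proof. by rewrite trmx_mul map_mxM. Qed.

Lemma adjmx1 n : (1%:M : 'M[C]_n) ^t* = 1%:M.
Proof. by rewrite trmx1 map_mx1. Qed.

Lemma mxtrace_adj n (A : 'M[C]_n) : \tr (A ^t*) = (\tr A)^*.
Proof. by rewrite trace_map_mx mxtrace_tr. Qed.

Lemma mxtrace_gram m n (A : 'M[C]_(m, n)) :
  \tr (A ^t* *m A) = \sum_i \sum_j `|A i j| ^+ 2.
Proof.
rewrite /mxtrace exchange_big /=; apply: eq_bigr => j _.
rewrite mxE; apply: eq_bigr => i _.
by rewrite !mxE mulrC normCK.
Qed.

Lemma gram_eq0 m n (A : 'M[C]_(m, n)) : \tr (A ^t* *m A) = 0 -> A = 0.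
Proof.
rewrite mxtrace_gram => /psumr_eq0P A0; apply/matrixP => i j.
have {}A0 :=
  A0 (fun i _ => sumr_ge0 _ (fun j _ => exprn_ge0 2 (normr_ge0 _))) i isT.
have /(_ j isT) := psumr_eq0P (fun j _ => exprn_ge0 2 (normr_ge0 _)) A0.
by move=> /eqP; rewrite expf_eq0 /= normr_eq0 mxE => /eqP.
Qed.

End Adjoint.

(** * Positive semidefinite matrices and the Loewner order *)

Section Psd.
Variables (C : numClosedFieldType) (n : nat).
Implicit Types (A B Z W X M : 'M[C]_n) (x : 'cV[C]_n).

Lemma psdmx0 : psdmx (0 : 'M[C]_n).
Proof. by split=> [|x]; rewrite ?trmx0 ?map_mx0 // mulmx0 mul0mx mxE. Qed.

Lemma psdmxD A B : psdmx A -> psdmx B -> psdmx (A + B).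
Proof.
move=> [hA pA] [hB pB]; split=> [|x]; first by rewrite adjmxD hA hB.
by rewrite mulmxDr mulmxDl mxE addr_ge0.
Qed.

Lemma psdmxZ (a : C) A : 0 <= a -> psdmx A -> psdmx (a *: A).
Proof.
move=> a0 [hA pA]; split=> [|x].
  by rewrite adjmxZ hA (CrealP (ger0_real a0)).
by rewrite -scalemxAr -scalemxAl mxE mulr_ge0.
Qed.

Lemma psdmx_congr M A : psdmx A -> psdmx (M ^t* *m A *m M).
Proof.
move=> [hA pA]; split=> [|x]; first by rewrite !adjmxM trmxCK hA mulmxA.
by have := pA (M *m x); rewrite adjmxM !mulmxA.
Qed.

Lemma psdmx1 : psdmx (1%:M : 'M[C]_n).
Proof.
split=> [|x]; first exact: adjmx1.
rewrite mulmx1 mxE; apply: sumr_ge0 => i _.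
by rewrite !mxE mulrC -normCK exprn_ge0.
Qed.

Lemma psdmx_gram M : psdmx (M ^t* *m M).
Proof. by have := psdmx_congr M psdmx1; rewrite mulmx1. Qed.

Lemma psdmx_diag_ge0 A i : psdmx A -> 0 <= A i i.
Proof.
move=> [_ /(_ (delta_mx i 0))].
by rewrite trmx_delta map_delta_mx -rowE -colE !mxE.
Qed.

Lemma psdmx_tr_ge0 A : psdmx A -> 0 <= \tr A.
Proof. by move=> pA; apply: sumr_ge0 => i _; apply: psdmx_diag_ge0. Qed.

(** The square [(mu - W Z)^* Z (mu - W Z)] and the congruence by [Z] of
    [mu W - W Z W] are both psd, and their sum is [mu (mu Z - Z W Z)]. *)
Lemma order_duality (mu : C) Z W : 0 < mu -> psdmx Z -> W ^t* = W ->
  psdmx (mu *: W - W *m Z *m W) -> psdmx (mu *: Z - Z *m W *m Z).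
Proof.
move=> mu0 pZ hW pW; have [hZ _] := pZ.
have mur : mu^* = mu by apply/CrealP/gtr0_real.
have := psdmxD (psdmx_congr (mu%:M - W *m Z) pZ) (psdmx_congr Z pW).
move=> /(psdmxZ (_ : 0 <= mu^-1)); rewrite invr_ge0 ltW // => /(_ isT).
congr psdmx; rewrite adjmxB adjmxM hW hZ tr_scalar_mx map_scalar_mx /= mur.
apply: (@scalerI _ _ mu); rewrite ?gt_eqF // scalerA divff ?gt_eqF // scale1r.
rewrite !(mulmxBl, mulmxBr, scalerBr) !mul_scalar_mx !mul_mx_scalar.
rewrite -?scalemxAl -?scalemxAr -?scalemxAl !mulmxA.
set a := Z *m W *m Z; set b := _ *m _ *m Z.
by rewrite subrK.
Qed.

Definition sum_norm m p (A : 'M[C]_(m, p)) : C := \sum_i \sum_j `|A i j|.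

Lemma sum_norm_ge0 A : 0 <= sum_norm A.
Proof. by apply: sumr_ge0 => i _; apply: sumr_ge0. Qed.

(** Each term of the quadratic form of [A] at [x] is at most [|A i j| |x|^2].
    The bound is cruder than the operator norm, but visibly continuous in [A]. *)
Lemma herm_le_sum_norm A : A ^t* = A -> psdmx ((sum_norm A)%:M - A).
Proof.
move=> hA; have rN := CrealP (ger0_real (sum_norm_ge0 A)).
split=> [|x]; first by rewrite adjmxB hA tr_scalar_mx map_scalar_mx /= rN.
rewrite mulmxBr mulmxBl mul_mx_scalar -scalemxAl.
have mxDE (X Y : 'M[C]_1) : (X + Y) 0 0 = X 0 0 + Y 0 0 by rewrite mxE.
have mxNE (X : 'M[C]_1) : (- X) 0 0 = - X 0 0 by rewrite mxE.
have mxZE a (X : 'M[C]_1) : (a *: X) 0 0 = a * X 0 0 by rewrite mxE.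
rewrite mxDE mxNE mxZE.
set q := (_ *m A *m x) 0 0; set s := (x ^t* *m x) 0 0.
have sE : s = \sum_i `|x i 0| ^+ 2.
  by rewrite /s mxE; apply: eq_bigr => i _; rewrite !mxE mulrC normCK.
have xs i : `|x i 0| ^+ 2 <= s.
  by rewrite sE (bigD1 i) //= lerDl sumr_ge0 // => j _; rewrite exprn_ge0.
have s0 : 0 <= s by rewrite sE sumr_ge0 // => j _; rewrite exprn_ge0.
have qr : q \is Num.real.
  have : (x ^t* *m A *m x) ^t* = x ^t* *m A *m x.
    by rewrite !adjmxM trmxCK hA mulmxA.
  rewrite /q; move: (_ *m x) => X hX.
  by apply/CrealP; rewrite -[in RHS]hX !mxE.
rewrite subr_ge0; apply: le_trans (real_ler_norm qr) _.
have qE : q = \sum_i \sum_j (x i 0)^* * A i j * x j 0.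
  rewrite exchange_big /q mxE; apply: eq_bigr => j _.
  by rewrite mxE mulr_suml; apply: eq_bigr => i _; rewrite !mxE.
rewrite qE mulr_suml; apply: le_trans (ler_norm_sum _ _ _) _.
apply: ler_sum => i _; rewrite mulr_suml.
apply: le_trans (ler_norm_sum _ _ _) _; apply: ler_sum => j _.
rewrite !normrM norm_conjC mulrAC [leLHS]mulrC ler_wpM2l //.
have : 0 <= (`|x i 0| - `|x j 0|) ^+ 2.
  by rewrite -realEsqr realB // normr_real.
have := lerD (xs i) (xs j).
move: (`|x i 0|) (`|x j 0|) => a b h1 h2.
rewrite -(@ler_pM2l _ 2) //.
have -> : 2 * (a * b) = a ^+ 2 + b ^+ 2 - (a - b) ^+ 2 by ring.
have -> : 2 * s = s + s by ring.
by rewrite lerBlDr (le_trans h1) // lerDl.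
Qed.

(** This is [order_duality] for [W = 1]. *)
Lemma psdmx_sqr_le A : psdmx A -> psdmx (sum_norm A *: A - A *m A).
Proof.
move=> pA; have [hA _] := pA.
have [N0|N0] := eqVneq (sum_norm A) 0.
  suff -> : A = 0 by rewrite mulmx0 scaler0 subr0; apply: psdmx0.
  apply: gram_eq0; rewrite mxtrace_gram big1 // => i _; rewrite big1 // => j _.
  have := psumr_eq0P (fun i _ => sumr_ge0 _ (fun j _ => normr_ge0 _)) N0.
  move=> /(_ i isT)/(psumr_eq0P (fun j _ => normr_ge0 _))/(_ j isT) ->.
  by rewrite expr0n.
have Np : 0 < sum_norm A by rewrite lt0r N0 sum_norm_ge0.
have := order_duality Np pA (adjmx1 _ _); rewrite mulmx1 mul1mx mulmx1; apply.
by rewrite scalemx1; apply: herm_le_sum_norm.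
Qed.

(** [(A M)^* (A M)] is at most a multiple of [M^* A M], by [psdmx_sqr_le]. *)
Lemma psdmx_annihil A M : psdmx A -> psdmx (- (M ^t* *m A *m M)) -> A *m M = 0.
Proof.
move=> pA pN; apply: gram_eq0; have [hA _] := pA.
have p1 : psdmx (M ^t* *m (sum_norm A *: A - A *m A) *m M).
  exact/psdmx_congr/psdmx_sqr_le.
have := psdmx_tr_ge0 (psdmxD p1 (psdmxZ (sum_norm_ge0 A) pN)).
rewrite mulmxBr mulmxBl -scalemxAr -scalemxAl scalerN addrAC subrr sub0r.
rewrite !mulmxA -[M ^t* *m A]trmxCK adjmxM hA trmxCK -mulmxA linearN oppr_ge0.
move=> le0; apply/eqP; rewrite eq_le; apply/andP; split => //.
exact/psdmx_tr_ge0/psdmx_gram.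
Qed.

End Psd.

(** * Functional calculus of self-adjoint matrices *)

Section FunctionalCalculus.
Variables (C : numClosedFieldType) (n : nat).
Implicit Types (A : 'M[C]_n) (f g : C -> C).

Definition eigval A i : C := spectral_diag A 0 i.

Definition mxfun A f : 'M[C]_n :=
  (spectralmx A) ^t* *m diag_mx (\row_i f (eigval A i)) *m spectralmx A.

Lemma spectralmxKV A : spectralmx A *m (spectralmx A) ^t* = 1%:M.
Proof. exact/unitarymxP/spectral_unitarymx. Qed.

Lemma spectralmxK A : (spectralmx A) ^t* *m spectralmx A = 1%:M.
Proof. exact/mulmx1C/spectralmxKV. Qed.

Lemma herm_hermsymmx A : A ^t* = A -> A \is hermsymmx.
Proof. by move=> hA; rewrite qualifE /= expr0 scale1r hA. Qed.

Lemma mxfun_id A : A ^t* = A -> mxfun A id = A.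
Proof.
move=> hA; have /orthomx_spectralP := hermitian_normalmx (herm_hermsymmx hA).
rewrite invmx_unitary ?spectral_unitarymx // => AE; rewrite [RHS]AE.
by rewrite /mxfun; congr (_ *m diag_mx _ *m _); apply/rowP => i; rewrite mxE.
Qed.

Lemma eq_mxfun A f g : (forall i, f (eigval A i) = g (eigval A i)) ->
  mxfun A f = mxfun A g.
Proof.
move=> fg; rewrite /mxfun; congr (_ *m diag_mx _ *m _).
by apply/rowP => i; rewrite !mxE fg.
Qed.

Lemma mxfunM A f g : mxfun A f *m mxfun A g = mxfun A (f \* g).
Proof.
rewrite /mxfun !mulmxA; congr (_ *m _).
rewrite -[_ *m spectralmx A *m _]mulmxA spectralmxKV mulmx1 -mulmxA mulmx_diag.
by congr (_ *m diag_mx _); apply/rowP => i; rewrite !mxE.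
Qed.

Lemma mxfunD A f g : mxfun A f + mxfun A g = mxfun A (f \+ g).
Proof.
rewrite /mxfun -mulmxDl -mulmxDr -linearD /=.
by congr (_ *m diag_mx _ *m _); apply/rowP => i; rewrite !mxE.
Qed.

Lemma mxfun_cst A (a : C) : mxfun A (fun=> a) = a%:M.
Proof.
rewrite /mxfun (_ : \row_i _ = const_mx a); last first.
  by apply/rowP => i; rewrite !mxE.
by rewrite diag_const_mx mul_mx_scalar -scalemxAl spectralmxK scalemx1.
Qed.

Lemma mxtrace_mxfun A f : \tr (mxfun A f) = \sum_i f (eigval A i).
Proof.
rewrite /mxfun mxtrace_mulC mulmxA spectralmxKV mul1mx mxtrace_diag.
by apply: eq_bigr => i _; rewrite mxE.
Qed.

Lemma eigval_real A i : A ^t* = A -> eigval A i \is Num.real.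
Proof.
by move=> hA; apply/mxOverP/hermitian_spectral_diag_real/herm_hermsymmx.
Qed.

Lemma adj_mxfun A f : (forall i, f (eigval A i) \is Num.real) ->
  (mxfun A f) ^t* = mxfun A f.
Proof.
move=> fr; rewrite /mxfun !adjmxM trmxCK mulmxA; congr (_ *m _ *m _).
rewrite tr_diag_mx map_diag_mx; congr diag_mx.
by apply/rowP => i; rewrite !mxE; apply/CrealP.
Qed.

Lemma psdmx_mxfun A f : (forall i, 0 <= f (eigval A i)) -> psdmx (mxfun A f).
Proof.
move=> f0; apply: psdmx_congr; split=> [|x].
  rewrite tr_diag_mx map_diag_mx; congr diag_mx.
  by apply/rowP => i; rewrite !mxE; apply/CrealP/ger0_real.
rewrite mxE; apply: sumr_ge0 => i _; rewrite mul_mx_diag !mxE mulrAC.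
by rewrite mulr_ge0 // mulrC -normCK exprn_ge0.
Qed.

Lemma psdmx_eigval_ge0 A i : psdmx A -> 0 <= eigval A i.
Proof.
move=> pA; have [hA _] := pA.
have := psdmx_diag_ge0 i (psdmx_congr ((spectralmx A) ^t*) pA).
rewrite trmxCK -{2}(mxfun_id hA) /mxfun !mulmxA spectralmxKV mul1mx.
by rewrite -mulmxA spectralmxKV mulmx1 !mxE eqxx mulr1n.
Qed.

End FunctionalCalculus.

(** * Real *-subalgebras and their states *)

Section Subalgebra.
Variables (C : numClosedFieldType) (n : nat) (S : set 'M[C]_n).
Hypothesis subalgS : real_star_subalgebra S.
Implicit Types (A B : 'M[C]_n) (f : C -> C).

Lemma subalg0 : S 0. Proof. by case: subalgS => -[[]]. Qed.

Lemma subalg1 : S 1%:M. Proof. by case: subalgS => -[]. Qed.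

Lemma subalg_adj A : S A -> S (A ^t*).
Proof. by case: subalgS => -[_ + _] _; apply. Qed.

Lemma subalgM A B : S A -> S B -> S (A *m B).
Proof. by case: subalgS => _; apply. Qed.

Lemma subalgD A B : S A -> S B -> S (A + B).
Proof.
case: subalgS => -[[_ lin] _ _] _ SA SB.
by have := lin 1 A B (real1 _) SA SB; rewrite scale1r.
Qed.

Lemma subalgZ (a : C) A : a \is Num.real -> S A -> S (a *: A).
Proof.
case: subalgS => -[[S0 lin] _ _] _ ar SA.
by have := lin a A 0 ar SA S0; rewrite addr0.
Qed.

Lemma subalgN A : S A -> S (- A).
Proof.
by move=> SA; rewrite -scaleN1r; apply: subalgZ; rewrite // realN real1.
Qed.

(** Newton interpolation: by induction on a finite set of real points, [f]
    agrees there with a function [g] for which [mxfun A g] is in [S], namely a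
    real polynomial. Working with functions [g] that are [good] instead of with
    polynomials avoids evaluating polynomials at matrices. *)
Lemma subalg_mxfun A f : S A -> A ^t* = A -> {homo f : x / x \is Num.real} ->
  S (mxfun A f).
Proof.
move=> SA hA fr.
pose good g := {homo g : x / x \is Num.real} /\ S (mxfun A g).
have goodM g h : good g -> good h -> good (g \* h).
  move=> [gr Sg] [hr Sh]; split; last by rewrite -mxfunM; apply: subalgM.
  by move=> x xr /=; rewrite realM ?gr ?hr.
have goodD g h : good g -> good h -> good (g \+ h).
  move=> [gr Sg] [hr Sh]; split; last by rewrite -mxfunD; apply: subalgD.
  by move=> x xr /=; rewrite realD ?gr ?hr.
have good_cst a : a \is Num.real -> good (fun=> a).
  move=> ar; split=> //; rewrite mxfun_cst -scalemx1.
  exact/subalgZ/subalg1.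
have good_id : good id by split=> //; rewrite mxfun_id.
have interp (s : seq C) : {in s, forall x, x \is Num.real} ->
    exists g v, [/\ good g, good v, {in s, g =1 f} &
                    forall x, (v x == 0) = (x \in s)].
  elim: s => [|a s IH] sr.
    exists (fun=> 0), (fun=> 1); split=> //; [exact: good_cst..|].
    by move=> x; rewrite oner_eq0 in_nil.
  have ar : a \is Num.real by apply: sr; rewrite mem_head.
  have [x xs|g [v [gg gv gf v0]]] := IH.
    by apply: sr; rewrite inE xs orbT.
  have [as_|as_] := boolP (a \in s).
    exists g, v; split=> //.
      by move=> x; rewrite inE => /orP[/eqP ->|]; apply: gf.
    by move=> x; rewrite v0 inE; case: eqP => // ->; rewrite as_.
  (* [v] vanishes exactly on [s], so a multiple of it corrects [g] at [a]. *)
  exists (g \+ ((fun=> (f a - g a) / v a) \* v)), (v \* (id \+ (fun=> - a))).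
  split.
  - apply: (goodD) => //; apply: goodM => //; apply: good_cst.
    by rewrite realM ?realV ?realB ?fr //; [case: gg => ->|case: gv => ->].
  - by apply: goodM => //; apply: goodD => //; apply: good_cst; rewrite realN.
  - move=> x; rewrite inE => /orP[/eqP ->|xs] /=.
      by rewrite divfK ?v0 // addrC subrK.
    by rewrite (eqP (_ : v x == 0)) ?v0 // mulr0 addr0 gf.
  - by move=> x /=; rewrite mulf_eq0 v0 subr_eq0 inE orbC.
have [x|g [v [[_ Sg] _ gf _]]] := interp [seq eigval A i | i : 'I_n].
  by move=> /mapP[i _ ->]; apply: eigval_real.
rewrite (@eq_mxfun _ _ _ _ g) // => i.
by apply/esym/gf/map_f; rewrite mem_enum.
Qed.

(** The negative part [N] of [A] is a psd element of [S] by [subalg_mxfun], so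
    [0 <= <A, N> = - tr (N^2)], which forces [N = 0]. *)
Lemma dual_cone_psdmx A : dual_cone S A -> psdmx A.
Proof.
move=> [[SA hA] dA]; pose f (x : C) : C := if 0 <= x then 0 else - x.
have fe i : 0 <= f (eigval A i).
  rewrite /f; case: ifPn => // /negP/negP.
  by rewrite -real_ltNge ?real0 ?eigval_real // oppr_ge0 => /ltW.
have Sf : S (mxfun A f).
  apply: subalg_mxfun => // x xr; rewrite /f; case: ifP => _ //.
  by rewrite realN.
have := dA _ (conj Sf (psdmx_mxfun fe)).
rewrite /mxinner hA -{1}(mxfun_id hA) mxfunM mxtrace_mxfun => sum0.
have fE i : eigval A i * f (eigval A i) = - (f (eigval A i)) ^+ 2.
  rewrite /f; case: ifP => _; first by rewrite mulr0 expr0n oppr0.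
  by rewrite sqrrN mulrN expr2.
move: sum0; under eq_bigr do rewrite /= fE.
rewrite sumrN oppr_ge0 => sum0.
have s2 i : 0 <= f (eigval A i) ^+ 2 by rewrite exprn_ge0.
have /psumr_eq0P f0 : \sum_i f (eigval A i) ^+ 2 = 0.
  by apply/eqP; rewrite eq_le sum0 sumr_ge0.
rewrite -(mxfun_id hA); apply: psdmx_mxfun => i /=.
have /eqP := f0 (fun i _ => s2 i) i isT; rewrite expf_eq0 /= /f.
case: ifP => // /negbT i0; rewrite oppr_eq0 => /eqP e0.
by rewrite e0 lexx in i0.
Qed.

(** With the square root [r(B)] of [B], the inner product is the trace of the
    psd matrix [r(B) A r(B)]. *)
Lemma psdmx_inner_ge0 A B : psdmx A -> psdmx B -> 0 <= mxinner A B.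
Proof.
move=> [hA pA] pB; have [hB _] := pB.
pose r (x : C) := sqrtC x.
have -> : B = mxfun B r *m mxfun B r.
  rewrite mxfunM -[LHS](mxfun_id hB); apply: eq_mxfun => i /=.
  by rewrite -expr2 sqrtCK.
have hr : (mxfun B r) ^t* = mxfun B r.
  by apply: adj_mxfun => i; rewrite ger0_real // sqrtC_ge0 psdmx_eigval_ge0.
rewrite /mxinner hA mulmxA mxtrace_mulC mulmxA -{1}hr.
by apply/psdmx_tr_ge0/psdmx_congr; split.
Qed.

Lemma state_spaceE : state_space S = [set A | [/\ S A, psdmx A & \tr A = 1]].
Proof.
apply/seteqP; split=> A /= [].
  by move=> dA tA; split=> //; [case: dA => -[] | apply: dual_cone_psdmx].
move=> SA pA tA; split=> //; split; first by case: pA.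
by move=> B [_ pB]; apply: psdmx_inner_ge0.
Qed.

End Subalgebra.

(** * Perturbing a dominated matrix *)

Section PseudoInverse.
Variables (C : numClosedFieldType) (n : nat) (S : set 'M[C]_n).
Hypothesis subalgS : real_star_subalgebra S.
Implicit Types (X Z W : 'M[C]_n).

(** [W] is [Y X Y] for the Moore-Penrose inverse [Y] of [Z]. From [X <= 2 Z] it
    follows that [X] vanishes on the kernel of [Z], hence [Z W Z = X]; and
    [Y X Y <= 2 Y Z Y = 2 Y] gives [X Y X <= 2 X] by [order_duality], hence
    [W Z W = Y (X Y X) Y <= 2 W]. *)
Lemma order_factor X Z : S X -> S Z -> psdmx X -> psdmx (2 *: Z - X) ->
  exists W, [/\ S W, psdmx W, Z *m W *m Z = X &
                psdmx (2 *: W - W *m Z *m W)].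
Proof.
move=> SX SZ pX pZX; have [hX _] := pX.
have pZ : psdmx Z.
  have := psdmxZ (_ : 0 <= 2^-1 :> C) (psdmxD pX pZX); rewrite invr_ge0 ler0n.
  by move=> /(_ isT); rewrite subrKC scalerA mulVf ?scale1r // pnatr_eq0.
have [hZ _] := pZ.
(* As [0^-1 = 0], this is the pseudo-inverse also when [Z] is singular. *)
pose Y := mxfun Z (fun x => x^-1).
have ZE := mxfun_id hZ.
have SY : S Y by apply: subalg_mxfun => // x; rewrite realV.
have pY : psdmx Y by apply: psdmx_mxfun => i; rewrite invr_ge0 psdmx_eigval_ge0.
have hY : Y ^t* = Y by case: pY.
have YZY : Y *m Z *m Y = Y.
  rewrite -{1}ZE !mxfunM; apply: eq_mxfun => i /=; set d := eigval _ _.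
  by have [->|d0] := eqVneq d 0; rewrite ?invr0 ?mul0r // mulVf // mul1r.
have YZ : Y *m Z = Z *m Y.
  by rewrite -{1 2}ZE !mxfunM; apply: eq_mxfun => i /=; rewrite mulrC.
have ZYZ : Z *m Y *m Z = Z.
  rewrite -{1 2 3}ZE !mxfunM; apply: eq_mxfun => i /=; set d := eigval _ _.
  by have [->|d0] := eqVneq d 0; rewrite ?mul0r // mulfV // mul1r.
clearbody Y.
(* [Q] is the orthogonal projection onto the kernel of [Z]. *)
pose Q := 1%:M - Y *m Z.
have hQ : Q ^t* = Q by rewrite adjmxB adjmx1 adjmxM hY hZ -YZ.
have ZQ : Z *m Q = 0 by rewrite mulmxBr mulmx1 mulmxA ZYZ subrr.
have XQ : X *m Q = 0.
  apply: psdmx_annihil => //; have := psdmx_congr Q pZX.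
  rewrite (mulmxBr (Q ^t*)) mulmxBl -scalemxAr -scalemxAl.
  by rewrite -[_ *m Z *m _]mulmxA ZQ mulmx0 scaler0 sub0r.
have XYZ : X *m (Y *m Z) = X.
  by apply/esym/eqP; rewrite -subr_eq0 -{1}[X]mulmx1 -mulmxBr XQ.
have ZYX : Z *m Y *m X = X.
  by have := congr1 (fun M => M ^t*) XYZ; rewrite 2!adjmxM hX hY hZ.
exists (Y *m X *m Y); split.
- by apply: (subalgM subalgS) => //; apply: (subalgM subalgS).
- by have := psdmx_congr Y pX; rewrite hY.
- by rewrite -!mulmxA XYZ mulmxA.
have -> : Y *m X *m Y *m Z *m (Y *m X *m Y) = Y *m (X *m Y *m X) *m Y.
  by rewrite !mulmxA -[Y *m X *m Y *m Z]mulmxA -[Y *m X *m _]mulmxA XYZ.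
have : psdmx (2 *: X - X *m Y *m X).
  apply: order_duality => //.
  have := psdmx_congr Y pZX; rewrite hY mulmxBr mulmxBl.
  by rewrite -scalemxAr -scalemxAl YZY.
move=> /(psdmx_congr Y); rewrite hY mulmxBr mulmxBl -scalemxAr -scalemxAl.
by rewrite !mulmxA.
Qed.

(** The hypothesis of [order_duality] passes from [Z] to [Z'] with the error
    [W (Z' - Z) W <= e W^2 <= e c W], where [e] and [c] are the [sum_norm] of
    [Z' - Z] and of [W]. *)
Lemma order_perturb Z Z' W : Z ^t* = Z -> psdmx Z' -> psdmx W ->
  psdmx (2 *: W - W *m Z *m W) ->
  psdmx ((2 + sum_norm (Z' - Z) * sum_norm W) *: Z' - Z' *m W *m Z').
Proof.
move=> hZ pZ' pW pWZ; have [hZ' _] := pZ'; have [hW _] := pW.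
set e := sum_norm _; have e0 : 0 <= e by apply: sum_norm_ge0.
have N0 := sum_norm_ge0 W.
apply: order_duality => //; first by rewrite ltr_wpDr // mulr_ge0.
have hE : (Z' - Z) ^t* = Z' - Z by rewrite adjmxB hZ hZ'.
have p1 := psdmx_congr W (herm_le_sum_norm hE).
have p2 := psdmxZ e0 (psdmx_sqr_le pW).
have := psdmxD pWZ (psdmxD p1 p2); congr psdmx.
rewrite hW !(mulmxBr, mulmxBl) mul_mx_scalar -scalemxAl -/e scalerBr scalerA.
rewrite [in RHS]scalerDl.
set a := W *m Z' *m W; set b := W *m Z *m W; set c := e *: (W *m W).
set p := 2 *: W; set q := _ *: W.
rewrite [c - _ + _]addrC [X in _ + X = _]addrA subrK.
by rewrite opprB addrCA [X in q + X = _]addrA subrK addrA [q + p]addrC.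
Qed.

End PseudoInverse.

(** * Continuity of matrix-valued functions *)

Section MatrixContinuity.
Variables (C : numClosedFieldType) (T : topologicalType).

Lemma continuous_mx m n (f : T -> 'M[C]_(m, n)) :
  (forall i j, continuous (fun x => f x i j)) -> continuous f.
Proof.
move=> cf x A [P MP sPA].
have : \forall y \near x, forall i j, P i j (f y i j).
  by apply: filter_forall => i; apply: filter_forall => j; apply/cf/MP.
by apply: filterS => y Py; apply: sPA.
Qed.

Lemma continuous_entry m n (f : T -> 'M[C]_(m, n)) i j :
  continuous f -> continuous (fun x => f x i j).
Proof.
move=> cf x; apply: (@continuous_comp _ _ _ f (fun M => M i j)).
  exact: cf.
exact: coord_continuous.
Qed.

Lemma continuous_sum I (r : seq I) (P : pred I) (f : I -> T -> C) :
  (forall i, P i -> continuous (f i)) ->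
  continuous (fun x => \sum_(i <- r | P i) f i x).
Proof.
by move=> cf x; apply: cvg_big => [|i Pi]; [exact: add_continuous|exact: cf].
Qed.

Lemma continuous_mulfun (f g : T -> C) :
  continuous f -> continuous g -> continuous (fun x => f x * g x).
Proof. by move=> cf cg x; apply: continuousM; [exact: cf|exact: cg]. Qed.

Lemma continuous_addfun (f g : T -> C) :
  continuous f -> continuous g -> continuous (fun x => f x + g x).
Proof. by move=> cf cg x; apply: continuousD; [exact: cf|exact: cg]. Qed.

Lemma continuous_subfun (f g : T -> C) :
  continuous f -> continuous g -> continuous (fun x => f x - g x).
Proof. by move=> cf cg x; apply: continuousB; [exact: cf|exact: cg]. Qed.

Lemma continuous_mulmx m n p (f : T -> 'M[C]_(m, n)) (g : T -> 'M[C]_(n, p)) :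
  continuous f -> continuous g -> continuous (fun x => f x *m g x).
Proof.
move=> cf cg; apply: continuous_mx => i k; under eq_fun do rewrite mxE.
apply: continuous_sum => j _.
by apply: continuous_mulfun; apply: continuous_entry.
Qed.

Lemma continuous_addmx m n (f g : T -> 'M[C]_(m, n)) :
  continuous f -> continuous g -> continuous (fun x => f x + g x).
Proof.
move=> cf cg; apply: continuous_mx => i j; under eq_fun do rewrite mxE.
by apply: continuous_addfun; apply: continuous_entry.
Qed.

Lemma continuous_summx m n I (r : seq I) (P : pred I)
    (f : I -> T -> 'M[C]_(m, n)) : (forall i, P i -> continuous (f i)) ->
  continuous (fun x => \sum_(i <- r | P i) f i x).
Proof.
move=> cf; apply: continuous_mx => i j; under eq_fun do rewrite summxE.
by apply: continuous_sum => k Pk; apply/continuous_entry/cf.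
Qed.

Lemma continuous_scalemx m n (c : T -> C) (f : T -> 'M[C]_(m, n)) :
  continuous c -> continuous f -> continuous (fun x => c x *: f x).
Proof.
move=> cc cf; apply: continuous_mx => i j; under eq_fun do rewrite mxE.
by apply: continuous_mulfun => //; apply: continuous_entry.
Qed.

Lemma continuous_submx m n (f g : T -> 'M[C]_(m, n)) :
  continuous f -> continuous g -> continuous (fun x => f x - g x).
Proof.
move=> cf cg; apply: continuous_mx => i j; under eq_fun do rewrite !mxE.
by apply: continuous_subfun; apply: continuous_entry.
Qed.

Lemma continuous_const (U : topologicalType) (u : U) :
  continuous (fun _ : T => u).
Proof. by move=> x; apply: cvg_cst. Qed.

Lemma continuous_mxtrace n (f : T -> 'M[C]_n) :
  continuous f -> continuous (fun x => \tr (f x)).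
Proof. by move=> cf; apply: continuous_sum => i _; apply: continuous_entry. Qed.

Lemma continuous_sum_norm n (f : T -> 'M[C]_n) :
  continuous f -> continuous (fun x => sum_norm (f x)).
Proof.
move=> cf; do 2![apply: continuous_sum => ? _].
move=> x; apply: continuous_comp; first exact: (continuous_entry cf).
exact: norm_continuous.
Qed.

Lemma continuous_conj (f : T -> C) :
  continuous f -> continuous (fun x => (f x)^*).
Proof.
move=> cf x; apply/cvgrPdist_lt => e e0.
have /cvgrPdist_lt/(_ e e0) := cf x.
by apply: filterS => y; rewrite -rmorphB norm_conjC.
Qed.

Lemma continuous_Re (f : T -> C) :
  continuous f -> continuous (fun x => 'Re (f x)).
Proof.
move=> cf; under eq_fun do rewrite ReE.
apply: continuous_mulfun; last exact: continuous_const.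
by apply: continuous_addfun => //; apply: continuous_conj.
Qed.

Lemma continuous_adjmx m n (f : T -> 'M[C]_(m, n)) :
  continuous f -> continuous (fun x => (f x) ^t*).
Proof.
move=> cf; apply: continuous_mx => i k; under eq_fun do rewrite !mxE.
exact/continuous_conj/continuous_entry.
Qed.

Lemma closed_eqfun (f g : T -> C) :
  continuous f -> continuous g -> closed [set x | f x = g x].
Proof.
move=> cf cg.
rewrite (_ : [set _ | _] = (fun x => f x - g x) @^-1` [set 0 : C]).
  apply: preimage_closed => [x _|]; last first.
    apply: accessible_closed_set1; apply: hausdorff_accessible.
    exact: norm_hausdorff.
  by apply: cvgB; [exact: cf|exact: cg].
apply/seteqP; split=> x /= fg; apply/eqP; rewrite ?subr_eq0 ?fg //.
by rewrite -subr_eq0 fg.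
Qed.

Lemma closed_eqmx m n (f g : T -> 'M[C]_(m, n)) :
  continuous f -> continuous g -> closed [set x | f x = g x].
Proof.
move=> cf cg.
rewrite (_ : [set _ | _] =
    \bigcap_(ij in [set: 'I_m * 'I_n]) [set x | f x ij.1 ij.2 = g x ij.1 ij.2]).
  by apply: closed_bigI => ij _; apply: closed_eqfun; apply: continuous_entry.
apply/seteqP; split=> x /= fg; first by move=> ij _ /=; rewrite fg.
by apply/matrixP => i j; apply: (fg (i, j)).
Qed.

(** The order of [C] is only partial, so closedness is read off from
    [0 <= z <-> `|z| = z]. *)
Lemma closed_ge0fun (f : T -> C) :
  continuous f -> closed [set x | 0 <= f x].
Proof.
move=> cf; rewrite (_ : [set _ | _] = [set x | `|f x| = f x]).
  apply: closed_eqfun => // x.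
  by apply: continuous_comp; [exact: cf|exact: norm_continuous].
apply/seteqP; split=> x /=; first exact: ger0_norm.
by move=> <-.
Qed.

End MatrixContinuity.

(** * The real inner product and the orthogonal projection *)

Section RealInner.
Variables (C : numClosedFieldType) (n : nat).
Implicit Types (A B : 'M[C]_n).

Definition re_inner A B : C := 'Re (mxinner A B).

Lemma re_inner_real A B : re_inner A B \is Num.real.
Proof. exact: Creal_Re. Qed.

Lemma re_innerZD (a : C) A A' B : a \is Num.real ->
  re_inner (a *: A + A') B = a * re_inner A B + re_inner A' B.
Proof.
move=> ar; rewrite /re_inner /mxinner adjmxD adjmxZ mulmxDl -scalemxAl.
by rewrite mxtraceD mxtraceZ (CrealP ar) raddfD /= ReMl.
Qed.

Lemma re_innerC A B : re_inner A B = re_inner B A.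
Proof. by rewrite /re_inner -Re_conj /mxinner -mxtrace_adj adjmxM trmxCK. Qed.

Lemma re_innerD A A' B : re_inner (A + A') B = re_inner A B + re_inner A' B.
Proof. by rewrite -{1}[A]scale1r re_innerZD ?real1 // mul1r. Qed.

Lemma re_inner0 B : re_inner 0 B = 0.
Proof. by apply: (addrI (re_inner 0 B)); rewrite -re_innerD !addr0. Qed.

Lemma re_innerZ (a : C) A B : a \is Num.real ->
  re_inner (a *: A) B = a * re_inner A B.
Proof. by move=> ar; rewrite -[_ *: _]addr0 re_innerZD // re_inner0 addr0. Qed.

Lemma re_innerB A A' B : re_inner (A - A') B = re_inner A B - re_inner A' B.
Proof. by rewrite re_innerD -scaleN1r re_innerZ ?realN ?real1 // mulN1r. Qed.

Lemma re_inner_suml I (r : seq I) (P : pred I) (F : I -> 'M[C]_n) B :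
  re_inner (\sum_(i <- r | P i) F i) B = \sum_(i <- r | P i) re_inner (F i) B.
Proof.
by apply: (big_morph (fun A => re_inner A B)) => [A A'|]; 
  rewrite ?re_innerD ?re_inner0.
Qed.

Lemma re_inner_adjl A B : re_inner (A ^t*) B = re_inner A (B ^t*).
Proof.
rewrite /re_inner /mxinner trmxCK -[RHS]Re_conj -mxtrace_adj adjmxM !trmxCK.
by rewrite mxtrace_mulC.
Qed.

Lemma mxinner_herm A B : A ^t* = A -> B ^t* = B -> mxinner A B = re_inner A B.
Proof.
move=> hA hB; apply/esym/Creal_ReP/CrealP.
by rewrite /mxinner -mxtrace_adj adjmxM trmxCK hA hB mxtrace_mulC.
Qed.

Lemma re_inner_tr A : re_inner A A = \tr (A ^t* *m A).
Proof.
by rewrite /re_inner; apply/Creal_ReP/ger0_real/psdmx_tr_ge0/psdmx_gram.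
Qed.

Lemma re_inner_ge0 A : 0 <= re_inner A A.
Proof. by rewrite re_inner_tr; apply/psdmx_tr_ge0/psdmx_gram. Qed.

Lemma re_inner_eq0 A : re_inner A A = 0 -> A = 0.
Proof. by rewrite re_inner_tr => /gram_eq0. Qed.

(** Coordinates in which [re_inner] is the standard bilinear form, used to bound
    the size of an orthonormal family by a rank. *)
Definition realify A : 'rV[C]_(n * n + n * n) :=
  row_mx (mxvec (map_mx (@Re C) A)) (mxvec (map_mx (@Im C) A)).

Lemma re_inner_realify A B : re_inner A B = (realify A *m (realify B)^T) 0 0.
Proof.
rewrite /realify tr_row_mx mul_row_col mxE !mxE -big_split /=.
rewrite (reindex _ (curry_mxvec_bij _ _)) /=.
rewrite /re_inner /mxinner /mxtrace raddf_sum /=.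
under eq_bigr => j _ do rewrite mxE raddf_sum /=.
rewrite exchange_big /= pair_bigA /=; apply: eq_bigr => -[i j] _ /=.
rewrite !mxE (mxvecE (map_mx (@Re C) A)) (mxvecE (map_mx (@Im C) A)).
rewrite (mxvecE (map_mx (@Re C) B)) (mxvecE (map_mx (@Im C) B)) !mxE.
by rewrite ReM Re_conj Im_conj mulNr opprK.
Qed.

Lemma real_subspace_sum (S : set 'M[C]_n) I (r : seq I) (c : I -> C)
    (F : I -> 'M[C]_n) :
  real_subspace S -> (forall i, c i \is Num.real) -> (forall i, S (F i)) ->
  S (\sum_(i <- r) c i *: F i).
Proof.
move=> [S0 lin] cr SF; elim: r => [|i r IH]; first by rewrite big_nil.
by rewrite big_cons; apply: lin.
Qed.

Definition orthonormal_upto k (e : nat -> 'M[C]_n) : Prop :=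
  forall i j, (i < k)%N -> (j < k)%N -> re_inner (e i) (e j) = (i == j)%:R.

Lemma orthonormal_bound k e : orthonormal_upto k e -> (k <= n * n + n * n)%N.
Proof.
move=> oe; pose G : 'M[C]_(k, n * n + n * n) := \matrix_(i < k) realify (e i).
have GG : G *m G^T = 1%:M.
  apply/matrixP => i j; rewrite !mxE -(oe i j) // re_inner_realify mxE.
  by apply: eq_bigr => l _; rewrite !mxE.
by rewrite -{1}(mxrank1 C k) -GG (leq_trans (mxrankM_maxl _ _)) // rank_leq_col.
Qed.

(** A longest orthonormal family in [S] exists by [orthonormal_bound]. It spans
    [S] over the reals: otherwise normalising the component of some [B] in [S]
    orthogonal to it would give a longer one. *)
Lemma orthonormal_basis (S : set 'M[C]_n) : real_subspace S ->
  exists k e, [/\ orthonormal_upto k e, forall i, S (e i) &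
    forall B, S B -> B = \sum_(i < k) re_inner (e i) B *: e i].
Proof.
move=> rS; have [S0 lin] := rS.
have SZ a B : a \is Num.real -> S B -> S (a *: B).
  by move=> ar SB; rewrite -[_ *: _]addr0; apply: lin.
pose P k := `[< exists e, orthonormal_upto k e /\ forall i, S (e i) >].
have exP : exists k, P k by exists 0%N; apply/asboolP; exists (fun=> 0).
have ubP k : P k -> (k <= n * n + n * n)%N.
  by move=> /asboolP[e [oe _]]; apply: orthonormal_bound oe.
case: (ex_maxnP exP ubP) => k /asboolP[e [oe Se]] kmax.
exists k, e; split=> // B SB; apply/eqP; rewrite -subr_eq0; apply/eqP.
set D := _ - _; apply: contrapT => D0.
have SD : S D.
  rewrite /D addrC -scaleN1r; apply: lin; rewrite ?realN ?real1 //.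
  by apply: real_subspace_sum => // i; apply: re_inner_real.
have Do i : (i < k)%N -> re_inner D (e i) = 0.
  move=> ik; rewrite re_innerB re_inner_suml (bigD1 (Ordinal ik)) //=.
  rewrite re_innerZ ?re_inner_real // oe // eqxx mulr1 big1 ?addr0.
    by rewrite re_innerC subrr.
  move=> j ji; rewrite re_innerZ ?re_inner_real // oe //.
  rewrite (_ : _ == _ = false) ?mulr0 //.
  by apply: contraNF ji => /eqP ji; apply/eqP/val_inj.
pose c := sqrtC (re_inner D D).
have c0 : c != 0 by rewrite sqrtC_eq0; apply/eqP => /re_inner_eq0.
have cr : c^-1 \is Num.real.
  by rewrite realV ger0_real // sqrtC_ge0 re_inner_ge0.
have /kmax : P k.+1; last by rewrite ltnn.
apply/asboolP; exists (fun i => if i == k then c^-1 *: D else e i).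
split; last first.
  by move=> i; case: ifP => _ //; apply: SZ.
have De i : (i < k)%N -> re_inner (c^-1 *: D) (e i) = 0.
  by move=> ik; rewrite re_innerZ // Do // mulr0.
move=> i j; rewrite !ltnS => ik jk.
case: eqP => [->|/eqP ik']; case: eqP => [->|/eqP jk'].
- rewrite eqxx re_innerZ // re_innerC re_innerZ // mulrA.
  by rewrite -(sqrtCK (re_inner D D)) -/c expr2 mulrACA mulVf // mulr1.
- by rewrite De ?ltn_neqAle ?jk' // eq_sym (negPf jk').
- by rewrite re_innerC De ?ltn_neqAle ?ik' // (negPf ik').
- by rewrite oe // ltn_neqAle ?ik' ?jk'.
Qed.

Lemma orthogonal_projectionP (S : set 'M[C]_n) : real_subspace S ->
  is_orthogonal_projection S (orthogonal_projection S).
Proof.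
move=> rS; have [k [e [oe Se BE]]] := orthonormal_basis rS; have [S0 lin] := rS.
apply: (@xgetPex _ (fun=> 0) [set f | is_orthogonal_projection S f]).
exists (fun A => \sum_(i < k) re_inner (e i) A *: e i); split.
- move=> a A B ar; rewrite scaler_sumr -big_split /=; apply: eq_bigr => i _.
  rewrite re_innerC re_innerZD // ![re_inner _ (e i)]re_innerC.
  by rewrite scalerDl scalerA.
- by move=> A; apply: real_subspace_sum => // i; apply: re_inner_real.
- move=> A B SB; rewrite -/(re_inner _ B) (BE B SB) re_innerC re_inner_suml.
  rewrite big1 //.
  move=> i _; rewrite re_innerZ ?re_inner_real //.
  rewrite [X in _ * X]re_innerC re_innerB re_inner_suml (bigD1 i) //=.
  rewrite big1 => [|j ji].
    rewrite re_innerZ ?re_inner_real // oe // eqxx mulr1 addr0.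
    by rewrite (re_innerC A) subrr mulr0.
  rewrite re_innerZ ?re_inner_real // oe // (_ : _ == _ = false) ?mulr0 //.
  by apply: contraNF ji => /eqP ji; apply/eqP/val_inj.
Qed.

(** The orthogonal expansion along a basis of [S] is continuous, and [S] is its
    set of fixed points. *)
Lemma real_subspace_closed (S : set 'M[C]_n) : real_subspace S -> closed S.
Proof.
move=> rS; have [k [e [oe Se BE]]] := orthonormal_basis rS; have [S0 lin] := rS.
rewrite (_ : S = [set B | B = \sum_(i < k) re_inner (e i) B *: e i]).
  apply: closed_eqmx; first by move=> x; exact: cvg_id.
  apply: continuous_summx => i _.
  apply: continuous_scalemx; last exact: continuous_const.
  rewrite /re_inner /mxinner; apply: continuous_Re.
  apply/continuous_mxtrace/continuous_mulmx; first exact: continuous_const.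
  by move=> x; exact: cvg_id.
apply/seteqP; split=> B /=; first exact: BE.
by move=> ->; apply: real_subspace_sum => // i; apply: re_inner_real.
Qed.

End RealInner.

(** * Compactness of the state space and the projection onto it *)

Section StateSpace.
Variables (C : numClosedFieldType) (n : nat) (S : set 'M[C]_n).
Hypothesis subalgS : real_star_subalgebra S.
Implicit Types (A B X Y Z : 'M[C]_n).
Local Notation K := (state_space S).

Lemma subalg_subspace : real_subspace S. Proof. by case: subalgS => -[]. Qed.

Lemma setT_subalgebra : real_star_subalgebra [set: 'M[C]_n].
Proof. by []. Qed.

Lemma stateP A : K A <-> [/\ S A, psdmx A & \tr A = 1].
Proof. by rewrite state_spaceE. Qed.

Lemma state_setT A : K A -> state_space [set: 'M[C]_n] A.
Proof.
by move=> /stateP[_ pA tA]; rewrite (state_spaceE setT_subalgebra).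
Qed.

Lemma state_comb (a b : C) A B : 0 <= a -> 0 <= b -> a + b = 1 ->
  K A -> K B -> K (a *: A + b *: B).
Proof.
move=> a0 b0 ab /stateP[SA pA tA] /stateP[SB pB tB]; apply/stateP; split.
- by apply: (subalgD subalgS); apply: (subalgZ subalgS) => //; apply: ger0_real.
- by apply: psdmxD; apply: psdmxZ.
- by rewrite mxtraceD !mxtraceZ tA tB !mulr1.
Qed.

Lemma state_midpoint X Y : K X -> K Y -> K (midpoint (X, Y)).
Proof.
move=> KX KY; rewrite /midpoint /= scalerDr.
by apply: state_comb; rewrite ?invr_ge0 // [RHS]splitr mul1r.
Qed.

Lemma state_convex : convex_set (K : set (convex_lmodType 'M[C]_n)).
Proof.
move=> A B t; rewrite !inE => KA KB; apply: state_comb => //.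
- by rewrite subr_ge0 le1.
- by rewrite /= addrC subrK.
Qed.

(** The sum of the squared moduli of the entries is the sum of the squared
    eigenvalues, and these are nonnegative with sum 1. *)
Lemma state_entry_le1 A i j : K A -> `|A i j| <= 1.
Proof.
move=> /stateP[_ pA tA]; have [hA _] := pA.
have : \tr (A ^t* *m A) <= 1.
  rewrite hA -(mxfun_id hA) mxfunM mxtrace_mxfun /= -tA -{3}(mxfun_id hA).
  rewrite mxtrace_mxfun; apply: ler_sum => k _.
  rewrite ler_piMr ?psdmx_eigval_ge0 // -tA -{2}(mxfun_id hA) mxtrace_mxfun.
  by rewrite (bigD1 k) //= lerDl sumr_ge0 // => l _; apply: psdmx_eigval_ge0.
rewrite mxtrace_gram => le1; rewrite -(@expr_le1 _ 2) //.
apply: le_trans le1; rewrite (bigD1 i) //= (bigD1 j) //= -addrA lerDl.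
rewrite addr_ge0 // sumr_ge0 // => k _; rewrite ?sumr_ge0 // => *;
  by rewrite exprn_ge0.
Qed.

Lemma state_closed : closed K.
Proof.
have cid : continuous (id : 'M[C]_n -> 'M[C]_n) by move=> A; exact: cvg_id.
rewrite (_ : K = S `&` [set A | A ^t* = A] `&` [set A | \tr A = 1] `&`
    \bigcap_(x in [set: 'cV[C]_n]) [set A | 0 <= (x ^t* *m A *m x) 0 0]).
  apply: closedI; [apply: closedI; [apply: closedI|]|].
  - exact: real_subspace_closed subalg_subspace.
  - by apply: closed_eqmx => //; apply: continuous_adjmx.
  - by apply: closed_eqfun; [exact: continuous_mxtrace|exact: continuous_const].
  - apply: closed_bigI => x _; apply: closed_ge0fun; apply: continuous_entry.
    apply: continuous_mulmx; last exact: continuous_const.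
    by apply: continuous_mulmx => //; exact: continuous_const.
apply/seteqP; split=> A.
  by move=> /stateP[SA [hA pA] tA]; split=> [|x _ /=]; [|exact: pA].
by move=> [[[SA hA] tA] pA]; apply/stateP; split=> //; split=> // x; apply: pA.
Qed.

Lemma mxdisk_compact m p : compact [set z : C | `|z| <= 1] ->
  compact [set A : 'M[C]_(m, p) | forall i j, `|A i j| <= 1].
Proof.
move=> cD; pose D := [set v : 'rV[C]_(m * p) | forall k, `|v 0 k| <= 1].
have cDv : compact D by apply: (@rV_compact C _ (fun=> [set z | `|z| <= 1])).
rewrite (_ : [set _ | _] = vec_mx @` D).
  apply: continuous_compact => //; apply: continuous_subspaceT.
  apply: continuous_mx => i j; under eq_fun do rewrite mxE.
  by apply: continuous_entry => v; exact: cvg_id.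
apply/seteqP; split=> [A A1|_ [v v1 <-] i j]; last by rewrite mxE.
exists (mxvec A); last exact: mxvecK.
by move=> k; case/mxvec_indexP: k => i j; rewrite mxvecE.
Qed.

Lemma state_compact : compact [set z : C | `|z| <= 1] -> compact K.
Proof.
move=> /(@mxdisk_compact n n) cD; apply: subclosed_compact cD _.
  exact: state_closed.
by move=> A KA i j; apply: state_entry_le1.
Qed.

Section Projection.
Variable p : 'M[C]_n -> 'M[C]_n.
Hypothesis proj_p : is_orthogonal_projection S p.

Lemma re_inner_proj A B : S B -> re_inner (p A) B = re_inner A B.
Proof.
case: proj_p => _ _ orth SB; apply/esym/eqP; rewrite -subr_eq0 -re_innerB.
by apply/eqP/orth.
Qed.

Lemma re_inner_inj A B : S A -> S B ->
  (forall X, S X -> re_inner A X = re_inner B X) -> A = B.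
Proof.
move=> SA SB AB; apply/eqP; rewrite -subr_eq0; apply/eqP/re_inner_eq0.
rewrite re_innerB; apply/eqP; rewrite subr_eq0; apply/eqP/AB.
exact/(subalgD subalgS)/(subalgN subalgS).
Qed.

Lemma proj_id A : S A -> p A = A.
Proof.
case: (proj_p) => _ Sp _ SA; apply: re_inner_inj => // X SX.
exact: re_inner_proj.
Qed.

(** Between self-adjoint matrices [mxinner] is real, so it agrees with
    [re_inner], which takes the same value on [A] and on [p A] against every
    element of [S]. The trace is the inner product with [1]. *)
Lemma proj_state A : state_space [set: 'M[C]_n] A -> K (p A).
Proof.
rewrite (state_spaceE setT_subalgebra) => -[_ pA tA]; have [hA _] := pA.
have [_ Sp _] := proj_p.
have hp : (p A) ^t* = p A.
  apply: re_inner_inj => //; first exact: (subalg_adj subalgS).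
  move=> X SX; rewrite re_inner_adjl !re_inner_proj //; last first.
    exact: (subalg_adj subalgS).
  by rewrite -re_inner_adjl hA.
split; [split=> // B [SB pB]|].
  have [hB _] := pB.
  by rewrite mxinner_herm // re_inner_proj // -mxinner_herm // psdmx_inner_ge0.
have tE X : X ^t* = X -> \tr X = re_inner X 1%:M.
  by move=> hX; rewrite -mxinner_herm ?adjmx1 // /mxinner hX mulmx1.
rewrite tE // re_inner_proj; last exact: (subalg1 subalgS).
by rewrite -tE.
Qed.

End Projection.

End StateSpace.

Lemma state_retraction (C : numClosedFieldType) n (S : set 'M[C]_n) :
  compact [set z : C | `|z| <= 1] -> real_star_subalgebra S ->
  retraction (state_space [set: 'M[C]_n]) (state_space S)
    (orthogonal_projection S).
Proof.
move=> cD subalgS.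
have proj := orthogonal_projectionP (subalg_subspace subalgS).
have [lin _ _] := proj; have sT := @setT_subalgebra C n; split.
- by split; [exact: state_compact | exact: state_convex].
- by split; [exact: state_compact | exact: state_convex].
- split=> [A|t A B _ _]; first exact: proj_state.
  have tr : t%:num \is Num.real by apply: ger0_real.
  rewrite [LHS]lin //; congr (_ + _).
  rewrite -[X in orthogonal_projection S X]addr0 lin ?realB ?real1 //.
  by rewrite (proj_id subalgS proj (subalg0 subalgS)) addr0.
- exists id; first by split=> [A|//]; exact: state_setT.
  move=> A; rewrite inE => /(stateP subalgS)[SA _ _].
  exact: proj_id subalgS _ proj _ SA.
Qed.

(** * Stability of the state space *)

Section Stability.
Variables (C : numClosedFieldType) (n : nat) (S : set 'M[C]_n).
Hypothesis subalgS : real_star_subalgebra S.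
Implicit Types (A B X Y Z : 'M[C]_n).
Local Notation K := (state_space S).

(** With [W] from [order_factor] and [t M = tr (M W M)], the map is
    [f M = l M W M + (1 - l t M) M], whose last coefficient restores trace 1.
    Let [2 + d M] be the constant of [order_perturb]. At [Z] we have [t = 1] and
    [d = 0], so the inequalities [0 <= 1 - l t] and [l (2 + d) <= 1 + l t] hold
    there with the positive margin [1 - l], hence also near [Z]. The first one
    gives [0 <= f M], and the second one [f M <= 2 M]. *)
Lemma midpoint_lift X Y (l : C) : K X -> K Y -> 0 < l -> l < 1 ->
  let Z := midpoint (X, Y) in
  exists f : 'M[C]_n -> 'M[C]_n, [/\ continuous f,
    f Z = l *: X + (1 - l) *: Z &
    \forall Z' \near Z, K Z' -> K (f Z') /\ K (2 *: Z' - f Z')].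
Proof.
move=> KX KY l0 l1 Z.
have KZ : K Z by exact: state_midpoint.
have ZE : 2 *: Z - X = Y.
  by rewrite scalerA mulfV ?pnatr_eq0 // scale1r /= addrAC subrr add0r.
have /(stateP subalgS)[SX pX tX] := KX; have /(stateP subalgS)[SY pY tY] := KY.
have /(stateP subalgS)[SZ pZ tZ] := KZ; have [hZ _] := pZ.
have [W [SW pW ZWZ pWZ]] : exists W, [/\ S W, psdmx W, Z *m W *m Z = X &
    psdmx (2 *: W - W *m Z *m W)] by apply: order_factor; rewrite ?ZE.
pose G (M : 'M[C]_n) := M *m W *m M.
pose t M := \tr (G M).
pose f M := l *: G M + (1 - l * t M) *: M.
pose d M := sum_norm (M - Z) * sum_norm W.
have cid : continuous (id : 'M[C]_n -> 'M[C]_n) by move=> A; exact: cvg_id.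
have cG : continuous G.
  apply: continuous_mulmx; last exact: cid.
  by apply: continuous_mulmx; [exact: cid|exact: continuous_const].
have ct : continuous t by apply: continuous_mxtrace.
have clt : continuous (fun M => l * t M).
  by apply: continuous_mulfun => //; exact: continuous_const.
have cd : continuous d.
  apply: continuous_mulfun; last exact: continuous_const.
  apply: continuous_sum_norm; apply: continuous_submx => //.
  exact: continuous_const.
have tZ1 : t Z = 1 by rewrite /t /G ZWZ.
have dZ0 : d Z = 0.
  rewrite /d subrr /sum_norm big1 ?mul0r // => i _; rewrite big1 // => j _.
  by rewrite mxE normr0.
exists f; split.
- apply: continuous_addmx.
    by apply: continuous_scalemx => //; exact: continuous_const.
  apply: continuous_scalemx => //.
  by apply: continuous_subfun => //; exact: continuous_const.
- by rewrite /f tZ1 /G ZWZ mulr1.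
have l1' : 0 < 1 - l by rewrite subr_gt0.
(* [1 - h M] is [1 + l t M - l (2 + d M)], with value [1 - l] at [Z]. *)
pose h M := l * (2 + d M - t M).
have ch : continuous h.
  apply: continuous_mulfun; first exact: continuous_const.
  apply: continuous_subfun => //; apply: continuous_addfun => //.
  exact: continuous_const.
have le1_near a b : b = l -> a \is Num.real -> `|b - a| < 1 - l -> a <= 1.
  move=> -> ar ba; rewrite -(lerD2r (- l)); apply: le_trans (ltW ba).
  by rewrite distrC; apply: real_ler_norm; apply: realB => //; apply: gtr0_real.
have near1 : \forall M \near Z, `|l * t Z - l * t M| < 1 - l.
  by have /cvgrPdist_lt/(_ _ l1') := clt Z.
have near2 : \forall M \near Z, `|h Z - h M| < 1 - l.
  by have /cvgrPdist_lt/(_ _ l1') := ch Z.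
apply: filterS2 near1 near2 => M; rewrite /h tZ1 dZ0 => n1 n2.
move=> /(stateP subalgS)[SM pM tM].
have [hM _] := pM; have lr := gtr0_real l0.
have pG : psdmx (G M) by have := psdmx_congr M pW; rewrite hM.
have t0 : 0 <= t M by apply: psdmx_tr_ge0.
have d0 : 0 <= d M by rewrite mulr_ge0 ?sum_norm_ge0.
have tr := ger0_real t0; have dr := ger0_real d0.
have lt1 : 0 <= 1 - l * t M.
  by rewrite subr_ge0; apply: (le1_near _ _ _ _ n1); rewrite ?mulr1 ?realM.
have lt2 : 0 <= 1 + l * t M - l * (2 + d M).
  have -> : 1 + l * t M - l * (2 + d M) = 1 - l * (2 + d M - t M) by ring.
  rewrite subr_ge0; apply: (le1_near _ _ _ _ n2); first by ring.
  by rewrite realM // realB // realD.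
have SG : S (G M) by do 2!apply: (subalgM subalgS) => //.
have Kf : K (f M).
  apply/(stateP subalgS); split.
  - apply: (subalgD subalgS); apply: (subalgZ subalgS) => //.
    exact: ger0_real.
  - by apply: psdmxD; apply: psdmxZ => //; apply: ltW.
  - by rewrite mxtraceD !mxtraceZ tM mulr1 -/(t M) addrC subrK.
split=> //; have /(stateP subalgS)[Sf pf tf] := Kf.
apply/(stateP subalgS); split.
- apply: (subalgD subalgS); last exact: (subalgN subalgS).
  exact: (subalgZ subalgS).
- have p1 := psdmxZ (ltW l0) (order_perturb hZ pM pW pWZ).
  have := psdmxD p1 (psdmxZ lt2 pM); congr psdmx.
  rewrite -/(d M) -/(G M) scalerBr scalerA addrAC -scalerDl.
  rewrite /f opprD [X in _ = _ + X]addrC [RHS]addrA -scalerBl.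
  by congr (_ *: _ - _); ring.
- by rewrite linearB /= mxtraceZ tM tf mulr1 -addrA subrr addr0.
Qed.

(** A pair [(X, Y)] in [U] is replaced by another one in [U], on the segments
    from [X] and [Y] to their midpoint [Z]; near that pair, [midpoint_lift]
    provides preimages in [U] of all states near [Z]. *)
Lemma state_stable : stable K.
Proof.
split; first exact: state_convex.
move=> U UK oU; rewrite openE => _ [[X Y] /= UXY <-].
have [/= KX KY] := UK _ UXY.
set Z := midpoint _.
have KZ : K Z by exact: state_midpoint.
have nbhsU P : U P -> \forall Q \near P, (K `*` K) Q -> U Q.
  move=> UP; have : nbhs (P : subspace (K `*` K)) U by exact: open_nbhs_nbhs.
  move=> /(nbhs_subspace_ex _ (UK _ UP))[V nV UV].
  apply: filterS nV => Q VQ KQ.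
  by have : (V `&` (K `*` K)) Q by []; rewrite -UV => -[].
pose c X (l : C) := l *: X + (1 - l) *: Z.
have cc X' : continuous (c X').
  apply: continuous_addmx; apply: continuous_scalemx;
    try exact: continuous_const.
    by move=> l; exact: cvg_id.
  apply: continuous_subfun; first exact: continuous_const.
  by move=> l; exact: cvg_id.
have KC X' l : 0 <= l -> l <= 1 -> K X' -> K (c X' l).
  move=> l0 l1 KX'; apply: (state_comb subalgS) => //; rewrite ?subr_ge0 //.
  by rewrite addrC subrK.
have c1 X' : c X' 1 = X' by rewrite /c subrr scale0r addr0 scale1r.
have [l [l0 l1 Ul]] : exists l, [/\ 0 < l, l < 1 & U (c X l, c Y l)].
  have near1 : \forall l \near (1 : C),
      (K `*` K) (c X l, c Y l) -> U (c X l, c Y l).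
    have := nbhsU _ UXY; rewrite -{1}(c1 X) -{1}(c1 Y).
    exact: (cvg_pair (cc X 1) (cc Y 1)).
  (* [l = 1 / (1 + e)] lies in the ball of radius [e] about 1. *)
  have [e /= e0 He] := (nbhs_ballP (1 : C) _).1 near1.
  have e1 : 0 < 1 + e by rewrite addr_gt0.
  have l0 : 0 < (1 + e)^-1 by rewrite invr_gt0.
  have l1 : (1 + e)^-1 < 1 by rewrite invf_lt1 // ltrDl.
  exists (1 + e)^-1; split=> //; apply: He; last first.
    by split; apply: KC => //; apply: ltW.
  rewrite /ball /= ger0_norm ?subr_ge0 ?ltW //.
  have -> : 1 - (1 + e)^-1 = e * (1 + e)^-1 by field; rewrite gt_eqF.
  by rewrite gtr_pMr.
have [f [cf fZ near_f]] := midpoint_lift KX KY l0 l1.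
have gZ : 2 *: Z - f Z = c Y l.
  by rewrite fZ; apply/matrixP => i j; rewrite !mxE /=; field.
have cg : continuous (fun M : 'M[C]_n => 2 *: M - f M).
  apply: continuous_submx => //.
  apply: continuous_scalemx; first exact: continuous_const.
  by move=> x; exact: cvg_id.
apply/(nbhs_subspace_ex _ KZ).
exists [set M | K M -> (@midpoint C n @` U) M]; last first.
  by apply/seteqP; split=> M [UM KM]; split=> //; exact: UM.
have nearU : \forall M \near Z,
    (K `*` K) (f M, 2 *: M - f M) -> U (f M, 2 *: M - f M).
  have := nbhsU _ Ul; rewrite -{1}gZ -{1}[c X l]fZ.
  exact: (cvg_pair (cf Z) (cg Z)).
apply: filterS2 nearU near_f => M h1 h2 /h2 KK.
exists (f M, 2 *: M - f M); first exact: h1.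
by rewrite /midpoint /= addrC subrK scalerA mulVf ?pnatr_eq0 // scale1r.
Qed.

End Stability.

(** * The complex numbers *)

Local Close Scope sesquilinear_scope.
Local Open Scope complex_scope.

Lemma continuous_real_complex (R : realType) :
  continuous (fun x : R => x%:C : (R[i] : numClosedFieldType)).
Proof.
move=> x; apply/cvgrPdist_lt => e e0.
have eE : e = (complex.Re e)%:C by rewrite RRe_real // gtr0_real.
have e0' : 0 < complex.Re e by move: e0; rewrite eE ltcR.
have /cvgrPdist_lt/(_ _ e0') : (fun y : R => y) @ x --> x by exact: cvg_id.
apply: filterS => y xy; rewrite eE -rmorphB.
by rewrite normc_def /= expr0n /= addr0 sqrtr_sqr ltcR.
Qed.

(** The disk is a closed subset of the continuous image of a compact square. *)
Lemma disk_compact (R : realType) :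
  compact [set z : (R[i] : numClosedFieldType) | `|z| <= 1].
Proof.
pose h (ab : R * R) : (R[i] : numClosedFieldType) := ab.1%:C + 'i%C * ab.2%:C.
have ch : continuous h.
  apply: continuous_addfun.
    move=> ab; apply: continuous_comp; first exact: cvg_fst.
    exact: continuous_real_complex.
  apply: continuous_mulfun; first exact: continuous_const.
  move=> ab; apply: continuous_comp; first exact: cvg_snd.
  exact: continuous_real_complex.
have cI : compact `[(-1 : R), 1] by exact: segment_compact.
have cQ : compact (h @` (`[(-1 : R), 1] `*` `[(-1 : R), 1])).
  apply: continuous_compact; first exact: continuous_subspaceT.
  exact: compact_setX.
apply: subclosed_compact cQ _.
  rewrite (_ : [set _ | _] =
      [set z : (R[i] : numClosedFieldType) | 0 <= 1 - `|z|]).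
    apply: closed_ge0fun.
    apply: continuous_subfun; first exact: continuous_const.
    exact: norm_continuous.
  by apply/seteqP; split=> z /=; rewrite subr_ge0.
move=> z /= z1; exists (complex.Re z, complex.Im z); last first.
  by rewrite /h /= -complexE.
have z2 : complex.Re z ^+ 2 + complex.Im z ^+ 2 <= 1.
  by rewrite -lecR add_Re2_Im2 expr_le1.
have r2 := sqr_ge0 (complex.Re z); have i2 := sqr_ge0 (complex.Im z).
split; rewrite /= in_itv /= -ler_norml -(@expr_le1 _ 2) //;
  rewrite real_normK ?num_real //; by apply: le_trans z2; rewrite ?lerDl ?lerDr.
Qed.

Theorem proposition5p2 (R : realType) (n : nat) (A : set 'M[R[i]]_n)
    (n_gt0 : (0 < n)%N) (subalgA : real_star_subalgebra A) :
  retraction (state_space [set: 'M[R[i]]_n]) (state_space A)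
    (orthogonal_projection A) /\
  stable (state_space A).
Proof.
split; last exact: state_stable.
exact/state_retraction/subalgA/disk_compact.
Qed.
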